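(* Let $A\in\mathbb{R}^{n\times n}$, $B\in\mathbb{R}^{n\times m}$, $Q\in\mathbb{R}^{n\times n}$, $S\in\mathbb{R}^{n\times m}$, $R\in\mathbb{R}^{m\times m}$ be such that $\Pi=\begin{bmatrix} Q & S \\ S^\top & R \end{bmatrix}=\Pi^\top\ge 0$, and let $\Sigma=(A,B;\Pi)$. Let $A_0=A-BR^\dagger S^\top$, $Q_0=Q-SR^\dagger S^\top$ and $\nu=\dim(\ker A_0)$. Let $U=[\,U_1\;\;U_2\,]\in\mathbb{R}^{n\times n}$ be an orthogonal matrix with $\operatorname{im}U_2=\ker A_0$ (so $U_2$ has $\nu$ columns). Let $A_U=U^\top A_0U=[\,\tilde A\;\;0_{n\times\nu}\,]$, where $\tilde A=\begin{bmatrix} A_1 \\ A_{21} \end{bmatrix}$ with $A_1\in\mathbb{R}^{(n-\nu)\times(n-\nu)}$ and $A_{21}\in\mathbb{R}^{\nu\times(n-\nu)}$. Partition conformably $B_U=U^\top B=\begin{bmatrix} B_1 \\ B_2 \end{bmatrix}$ and $Q_U=U^\top Q_0U=\begin{bmatrix} Q_{11} & Q_{12} \\ Q_{12}^\top & Q_{22} \end{bmatrix}$, with $B_1\in\mathbb{R}^{(n-\nu)\times m}$, $B_2\in\mathbb{R}^{\nu\times m}$, $Q_{11}\in\mathbb{R}^{(n-\nu)\times(n-\nu)}$, $Q_{22}\in\mathbb{R}^{\nu\times\nu}$. Finally let $Q_1=\tilde A^\top Q_U\tilde A$, $S_1=\tilde A^\top Q_UB_U$, $R_1=R+B_U^\top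 Q_UB_U$. 1. Let $X$ be a solution of CGDARE($\Sigma$), and partition $X_U=U^\top XU=\begin{bmatrix} X_{11} & X_{12} \\ X_{12}^\top & X_{22} \end{bmatrix}$ with $X_{11}\in\mathbb{R}^{(n-\nu)\times(n-\nu)}$ and $X_{22}\in\mathbb{R}^{\nu\times\nu}$. Then: (i) $X_{12}=Q_{12}$ and $X_{22}=Q_{22}$; (ii) the matrix $\Pi_1=\begin{bmatrix} Q_1 & S_1 \\ S_1^\top & R_1 \end{bmatrix}$ is positive semidefinite; (iii) $\Delta_1=X_{11}-Q_{11}$ satisfies CGDARE($\Sigma_1$) with $\Sigma_1=(A_1,B_1;\Pi_1)$, that is, $$\Delta_1=A_1^\top\Delta_1A_1-(A_1^\top\Delta_1B_1+S_1)(R_1+B_1^\top\Delta_1B_1)^\dagger(B_1^\top\Delta_1A_1+S_1^\top)+Q_1,$$ $$\ker(R_1+B_1^\top\Delta_1B_1)\subseteq\ker(S_1+A_1^\top\Delta_1B_1).$$ 2. Conversely, if $\Delta_1$ is a (symmetric) solution of the two relations in (iii), then $$X=U\begin{bmatrix} \Delta_1+Q_{11} & Q_{12} \\ Q_{12}^\top & Q_{22} \end{bmatrix}U^\top$$ is a solution of CGDARE($\Sigma$).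
   Context: $M^\dagger$ denotes the Moore-Penrose pseudo-inverse of a real matrix $M$. For $\Sigma=(A,B;\Pi)$ with $\Pi=\begin{bmatrix} Q & S \\ S^\top & R \end{bmatrix}=\Pi^\top\ge0$ (positive semidefinite), CGDARE($\Sigma$) (the constrained generalized discrete-time algebraic Riccati equation) is the pair of relations in the unknown $X$ $$X=A^\top XA-(A^\top XB+S)(R+B^\top XB)^\dagger(S^\top+B^\top XA)+Q,$$ $$\ker(R+B^\top XB)\subseteq\ker(A^\top XB+S).$$ Only real symmetric solutions are considered: ''solution'' always means real symmetric solution. *)

(* Defs.v *)
From HB Require Import structures.
From mathcomp Require Import all_boot all_order all_algebra.
From mathcomp Require Import reals.
Set Implicit Arguments. Unset Strict Implicit. Unset Printing Implicit Defensive.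
Import Order.TTheory GRing.Theory Num.Theory.
Local Open Scope ring_scope.

(* MathComp's [kermx] is the kernel of the action on row vectors, and its [%MS]
   subspaces are row spaces.  A subspace of column vectors is represented here
   by the row space of the transposes of its elements. *)
Definition colker (F : fieldType) (m n : nat) (M : 'M[F]_(m, n)) : 'M[F]_n :=
  kermx M^T.

Definition colim (F : fieldType) (m n : nat) (M : 'M[F]_(m, n)) : 'M[F]_(n, m) :=
  M^T.

Lemma colkerP (F : fieldType) (m n : nat) (M : 'M[F]_(m, n)) (v : 'cV[F]_n) :
  reflect (M *m v = 0) (v^T <= colker M)%MS.
Proof.
apply: (iffP sub_kermxP); rewrite -trmx_mul => H; last by rewrite H trmx0.
by apply: trmx_inj; rewrite H trmx0.
Qed.

Lemma colimP (F : fieldType) (m n : nat) (M : 'M[F]_(m, n)) (v : 'cV[F]_m) :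
  reflect (exists w : 'cV[F]_n, v = M *m w) (v^T <= colim M)%MS.
Proof.
apply: (iffP submxP) => [[w Hw]|[w ->]].
  by exists w^T; apply: trmx_inj; rewrite Hw trmx_mul trmxK.
by exists w^T; rewrite trmx_mul.
Qed.

(* [U] is allowed a column dimension [p] that is only provably equal to [n];
   the two equations together force [p = n]. *)
Definition orthogonal_mx (F : fieldType) (n p : nat) (U : 'M[F]_(n, p)) : Prop :=
  U^T *m U = 1%:M /\ U *m U^T = 1%:M.

Definition psd_mx (F : realFieldType) (n : nat) (M : 'M[F]_n) : Prop :=
  M^T = M /\ forall x : 'cV[F]_n, 0 <= (x^T *m M *m x) 0 0.

(* The four Penrose equations.  The library's [pinvmx] is only a partial
   inverse and does not satisfy the two symmetry conditions. *)
Definition penrose (F : realFieldType) (m n : nat)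
    (M : 'M[F]_(m, n)) (P : 'M[F]_(n, m)) : bool :=
  [&& M *m P *m M == M, P *m M *m P == P,
      (M *m P)^T == M *m P & (P *m M)^T == P *m M].

Lemma gram_unitmx (F : realFieldType) (r n : nat) (M : 'M[F]_(r, n)) :
  row_free M -> M *m M^T \in unitmx.
Proof.
move=> Mfree; rewrite -row_free_unit -kermx_eq0; apply/eqP/row_matrixP => i.
rewrite row0; set x := row i _.
have xG : x *m (M *m M^T) = 0 by rewrite -row_mul mulmx_ker row0.
have xM : x *m M = 0.
  have : (x *m M *m (x *m M)^T) 0 0 = 0.
    by rewrite trmx_mul !mulmxA -(mulmxA x) xG mul0mx mxE.
  rewrite mxE => /eqP; rewrite psumr_eq0 => [/allP H|j _]; last first.
    by rewrite [_^T _ _]mxE -expr2 sqr_ge0.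
  apply/rowP => j; have := H j (mem_index_enum _).
  by rewrite [_^T _ _]mxE mulf_eq0 orbb => /eqP ->; rewrite mxE.
by apply: (row_free_inj Mfree); rewrite xM mul0mx.
Qed.

Lemma penrose_exists (F : realFieldType) (m n : nat) (M : 'M[F]_(m, n)) :
  exists P, penrose M P.
Proof.
have [r [C [L [ML Cu Lu]]]] : exists r (C : 'M[F]_(m, r)) (L : 'M[F]_(r, n)),
    [/\ M = C *m L, C^T *m C \in unitmx & L *m L^T \in unitmx].
  exists (\rank M), (col_base M), (row_base M); split.
  - by rewrite mulmx_base.
  - rewrite -{2}(trmxK (col_base M)); apply: gram_unitmx.
    by rewrite /row_free mxrank_tr; apply: col_base_full.
  - exact/gram_unitmx/row_base_free.
pose P := L^T *m invmx (L *m L^T) *m (invmx (C^T *m C) *m C^T).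
have MP : M *m P = C *m invmx (C^T *m C) *m C^T.
  by rewrite ML /P !mulmxA -(mulmxA C) -(mulmxA C) mulmxV // mulmx1.
have PM : P *m M = L^T *m invmx (L *m L^T) *m L.
  rewrite ML /P !mulmxA; congr (_ *m _).
  by rewrite -!mulmxA mulVmx // mulmx1.
exists P; apply/and4P; split; apply/eqP.
- by rewrite MP ML -!mulmxA (mulmxA C^T) (mulmxA (invmx _)) mulVmx // mul1mx.
- rewrite PM /P -!mulmxA (mulmxA L (L^T)) (mulmxA (invmx (L *m _))).
  by rewrite mulVmx // mul1mx.
- by rewrite MP !trmx_mul trmx_inv trmx_mul !trmxK mulmxA.
- by rewrite PM !trmx_mul trmx_inv trmx_mul !trmxK mulmxA.
Qed.

Lemma penrose_uniq (F : realFieldType) (m n : nat) (M : 'M[F]_(m, n))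
    (P P' : 'M[F]_(n, m)) : penrose M P -> penrose M P' -> P = P'.
Proof.
case/and4P=> /eqP a1 /eqP a2 /eqP a3 /eqP a4.
case/and4P=> /eqP b1 /eqP b2 /eqP b3 /eqP b4.
have e1 : M *m P = M *m P'.
  rewrite -{1}b1 -mulmxA -b3 -{1}a3 -trmx_mul.
  by rewrite !mulmxA a1.
have e2 : P *m M = P' *m M.
  rewrite -{1}b1 !mulmxA -(mulmxA (P *m M)) -a4 -{1}b4 -trmx_mul.
  by rewrite -!mulmxA (mulmxA M) a1.
by rewrite -a2 -mulmxA e1 mulmxA e2 b2.
Qed.

Definition mpinv (F : realFieldType) (m n : nat) (M : 'M[F]_(m, n)) :
  'M[F]_(n, m) := xchoose (penrose_exists M).

Lemma mpinvP (F : realFieldType) (m n : nat) (M : 'M[F]_(m, n)) :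
  penrose M (mpinv M).
Proof. exact: xchooseP. Qed.

Definition cgdare_solution (F : realFieldType) (n m : nat)
    (A : 'M[F]_n) (B : 'M[F]_(n, m))
    (Q : 'M[F]_n) (S : 'M[F]_(n, m)) (R : 'M[F]_m) (X : 'M[F]_n) : Prop :=
  [/\ X^T = X,
      X = A^T *m X *m A
          - (A^T *m X *m B + S) *m mpinv (R + B^T *m X *m B)
              *m (S^T + B^T *m X *m A)
          + Q
    & (colker (R + B^T *m X *m B) <= colker (A^T *m X *m B + S))%MS].

(* Main.v *)
Require Import Defs.
From HB Require Import structures.
From mathcomp Require Import all_boot all_order all_algebra.
From mathcomp Require Import reals.
From mathcomp Require Import ring lra.
Set Implicit Arguments. Unset Strict Implicit. Unset Printing Implicit Defensive.
Import Order.TTheory GRing.Theory Num.Theory.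
Local Open Scope ring_scope.

(* When S = K^T R, which Pi >= 0 provides with K = R^+ S^T, the kernel condition
   says that the gain equation (R + B^T X B) G = S^T + B^T X A is solvable in G,
   and the Riccati equation then reads X = A^T X A - G^T (R + B^T X B) G + Q for
   any such G, so that the pseudo-inverse disappears.  In this form the feedback
   by K (G -> G - K) and the change of basis by U are immediate, and they reduce
   the problem to S = 0 and A = [At 0].  There the second block G2 of the gain
   satisfies (R + B^T X B) G2 = 0, so X - Q vanishes outside its leading block
   D; substituting X = Q + diag (D, 0) turns the two equations for X into those
   for D. *)

(* Matrix products are atoms here: only their additive structure is used. *)
Ltac mx_ring :=
  let i := fresh "i" in let j := fresh "j" in
  apply/matrixP => i j;
  repeat rewrite ?[fun_of_matrix (_ + _) _ _]mxE ?[fun_of_matrix (- _) _ _]mxE;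
  ring.

(** A row space is the annihilator of the kernel, so inclusions reverse. This turns a kernel
    condition into a factorization [N = D *m M]. *)
Lemma colker_sub (F : fieldType) (m p n : nat) (M : 'M[F]_(m, n)) (N : 'M[F]_(p, n)) :
  (colker M <= colker N)%MS = (N <= M)%MS.
Proof.
apply/idP/idP => [kMN | /submxP[D ->]]; last first.
  by apply/sub_kermxP; rewrite trmx_mul mulmxA mulmx_ker mul0mx.
rewrite submxE -trmx_eq0 trmx_mul; apply/eqP/sub_kermxP.
apply: submx_trans kMN; apply/sub_kermxP.
by rewrite -trmx_mul mulmx_coker trmx0.
Qed.

Lemma sym_congr (F : fieldType) (n p : nat) (M : 'M[F]_n) (T : 'M[F]_(n, p)) :
  M^T = M -> (T^T *m M *m T)^T = T^T *m M *m T.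
Proof. by move=> symM; rewrite !trmx_mul trmxK symM mulmxA. Qed.

(** * Positive semidefinite matrices and Schur complements *)

Section Psd.
Variable F : realFieldType.

Lemma psd_congr (n p : nat) (M : 'M[F]_n) (T : 'M[F]_(n, p)) :
  psd_mx M -> psd_mx (T^T *m M *m T).
Proof.
move=> [symM posM]; split=> [|x]; first exact: sym_congr.
by have := posM (T *m x); rewrite trmx_mul !mulmxA.
Qed.

Lemma psd_add (n : nat) (M N : 'M[F]_n) :
  psd_mx M -> psd_mx N -> psd_mx (M + N).
Proof.
move=> [symM posM] [symN posN]; split=> [|x]; first by rewrite linearD /= symM symN.
by rewrite mulmxDr mulmxDl mxE addr_ge0.
Qed.

Lemma normsq_eq0 (n : nat) (y : 'cV[F]_n) : (y^T *m y) 0 0 = 0 -> y = 0.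
Proof.
rewrite mxE => /eqP; rewrite psumr_eq0 => [/allP H|j _]; last first.
  by rewrite [_^T _ _]mxE -expr2 sqr_ge0.
apply/colP => j; have := H j (mem_index_enum _).
by rewrite [_^T _ _]mxE mulf_eq0 orbb mxE => /eqP.
Qed.

(** With [y = M *m x], the form at [t *: x + y] is affine in [t] with slope twice the squared norm
    of [y]. Being nonnegative for all [t], it has slope zero. *)
Lemma psd_isotropic (n : nat) (M : 'M[F]_n) (x : 'cV[F]_n) :
  psd_mx M -> (x^T *m M *m x) 0 0 = 0 -> M *m x = 0.
Proof.
move=> [symM posM] x0; set y := M *m x.
have yt : x^T *m M = y^T by rewrite trmx_mul symM.
apply: normsq_eq0; set c := (y^T *m y) 0 0.
have pos t : 0 <= (y^T *m M *m y) 0 0 + 2 * t * c.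
  have := posM (t *: x + y).
  rewrite [(_ + _)^T]linearD /= [(_ *: _)^T]linearZ /=.
  rewrite !(mulmxDl, mulmxDr) -!scalemxAl -!scalemxAr yt.
  rewrite -(mulmxA y^T M x) -/y ![fun_of_matrix (_ + _) _ _]mxE.
  rewrite ![fun_of_matrix (_ *: _) _ _]mxE -/c.
  by move: x0; rewrite yt => ->; lra.
apply/eqP/negP => /negP c0.
(* This [t] makes the affine function equal to -1. *)
have := pos (- ((y^T *m M *m y) 0 0 + 1) / (2 * c)).
have -> : 2 * (- ((y^T *m M *m y) 0 0 + 1) / (2 * c)) * c
  = - ((y^T *m M *m y) 0 0 + 1) by field.
lra.
Qed.

Lemma psd_block_dr (n m : nat) (Q : 'M[F]_n) (S : 'M[F]_(n, m)) (R : 'M[F]_m) :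
  psd_mx (block_mx Q S S^T R) -> psd_mx R.
Proof.
move=> /(psd_congr (col_mx 0 1%:M)).
rewrite tr_col_mx trmx0 trmx1 mul_row_block mul_row_col.
by rewrite !(mul0mx, mul1mx, mulmx0, mulmx1, add0r).
Qed.

(** If [R *m w = 0], then (0, w) is isotropic for the block matrix, hence in its kernel, and the
    upper block reads [S *m w = 0]. *)
Lemma psd_block_cross (n m : nat) (Q : 'M[F]_n) (S : 'M[F]_(n, m)) (R : 'M[F]_m) :
  psd_mx (block_mx Q S S^T R) -> (S <= R)%MS.
Proof.
move=> psdPi; rewrite -colker_sub; apply/rV_subP => v.
rewrite -[v]trmxK => /colkerP; set w := v^T => Rw; apply/colkerP.
have := @psd_isotropic _ _ (col_mx 0 w) psdPi.
rewrite tr_col_mx trmx0 mul_row_block mul_row_col mul_block_col.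
rewrite !(mul0mx, mulmx0, add0r) -mulmxA Rw mulmx0 mxE => /(_ erefl).
by move=> /(congr1 usubmx); rewrite col_mxKu linear0.
Qed.

(** Congruence by the column (1, -K): the [R]-terms combine to [- K^T *m R *m K]. *)
Lemma psd_schur (n m : nat) (Q : 'M[F]_n) (R : 'M[F]_m) (K : 'M[F]_(m, n)) :
  psd_mx (block_mx Q (K^T *m R) (K^T *m R)^T R) -> psd_mx (Q - K^T *m R *m K).
Proof.
move=> psdPi; have [symR _] := psd_block_dr psdPi.
move: psdPi => /(psd_congr (col_mx 1%:M (- K))).
rewrite tr_col_mx trmx1 mul_row_block mul_row_col [(- K)^T]linearN /=.
rewrite trmx_mul trmxK symR !(mul1mx, mulmx1, mulNmx, mulmxN, mulmxDl, mulmxA).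
by rewrite subrr ?mul0mx ?oppr0 addr0.
Qed.
End Psd.

(** * The Riccati equation in terms of a gain *)

Section Gain.
Variable F : realFieldType.

Definition gdare_gain (n m : nat) (A : 'M[F]_n) (B : 'M[F]_(n, m)) (Q : 'M[F]_n)
    (S : 'M[F]_(n, m)) (R : 'M[F]_m) (X : 'M[F]_n) (G : 'M[F]_(m, n)) : Prop :=
  (R + B^T *m X *m B) *m G = S^T + B^T *m X *m A /\
  X = A^T *m X *m A - G^T *m (R + B^T *m X *m B) *m G + Q.

(** Write V for [R + B^T *m X *m B] and W for [A^T *m X *m B + S]. The kernel condition is W = D V,
    so [D^T] is a gain. For any gain, W = [G^T] V, and the Penrose equation for V removes the
    pseudo-inverse. *)
Lemma cgdareP (n m : nat) (A : 'M[F]_n) (B : 'M[F]_(n, m)) (Q : 'M[F]_n)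
    (S : 'M[F]_(n, m)) (R : 'M[F]_m) (X : 'M[F]_n) :
  R^T = R ->
  cgdare_solution A B Q S R X <-> X^T = X /\ exists G, gdare_gain A B Q S R X G.
Proof.
move=> symR; rewrite /cgdare_solution /gdare_gain colker_sub.
have trW : X^T = X -> (A^T *m X *m B + S)^T = S^T + B^T *m X *m A.
  by move=> symX; rewrite linearD /= !trmx_mul trmxK symX addrC mulmxA.
have trV : X^T = X -> (R + B^T *m X *m B)^T = R + B^T *m X *m B.
  by move=> symX; rewrite linearD /= sym_congr ?symR.
set W := A^T *m X *m B + S in trW *; set V := R + _ in trV *.
have WPW (G : 'M_(m, n)) : X^T = X -> V *m G = S^T + B^T *m X *m A ->
    W *m mpinv V *m (S^T + B^T *m X *m A) = G^T *m V *m G.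
  move=> symX VG; have := mpinvP V; case/and4P => /eqP VPV _ _ _.
  have -> : W = G^T *m V by rewrite -(trmxK W) trW // -VG trmx_mul trV.
  by rewrite -VG !mulmxA -(mulmxA G^T) -(mulmxA G^T) VPV.
split=> [[symX eqX /submxP[D defW]] | [symX [G [VG eqX]]]].
  have VG : V *m D^T = S^T + B^T *m X *m A by rewrite -trW // defW trmx_mul trV.
  by split=> //; exists D^T; split; rewrite // -(WPW _ symX VG).
split=> //; first by rewrite (WPW _ symX VG).
by apply/submxP; exists G^T; rewrite -(trmxK W) trW // -VG trmx_mul trV.
Qed.

(** Both sides of the gain equation shift by [V *m K]. Given that equation, the two Riccati
    right-hand sides agree after expansion. *)
Lemma gain_feedback (n m : nat) (A : 'M[F]_n) (B : 'M[F]_(n, m)) (Q : 'M[F]_n)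
    (R : 'M[F]_m) (X : 'M[F]_n) (K G : 'M[F]_(m, n)) :
  R^T = R -> X^T = X ->
  gdare_gain (A + B *m K) B Q (K^T *m R) R X (G + K)
  <-> gdare_gain A B (Q - K^T *m R *m K) 0 R X G.
Proof.
move=> symR symX; rewrite /gdare_gain trmx0 add0r trmx_mul trmxK symR.
have [V defV] : exists V, V = R + B^T *m X *m B by exists (R + B^T *m X *m B).
rewrite -defV; have trV : V^T = V by rewrite defV linearD /= sym_congr ?symR.
have BXBK : R *m K + B^T *m X *m (A + B *m K) = B^T *m X *m A + V *m K.
  rewrite defV !(mulmxDr, mulmxDl, mulmxA); mx_ring.
rewrite BXBK mulmxDr.
have expand : V *m G = B^T *m X *m A ->
    (A + B *m K)^T *m X *m (A + B *m K) - (G + K)^T *m V *m (G + K) + Q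
    = A^T *m X *m A - G^T *m V *m G + (Q - K^T *m R *m K).
  move=> VG; have GV : G^T *m V = A^T *m X *m B.
    by rewrite -[LHS]trmxK trmx_mul trV trmxK VG !trmx_mul trmxK symX mulmxA.
  rewrite ![(_ + _)^T]linearD /= trmx_mul.
  rewrite (mulmxDl G^T) GV !(mulmxDl, mulmxDr) -(mulmxA K^T V G) VG defV.
  rewrite !(mulmxDl, mulmxDr, mulmxA); mx_ring.
by split=> [[/addIr VG eqX] | [VG eqX]]; split; rewrite ?VG // {1}eqX expand.
Qed.

(** Applied to [U] and to [U^T], this gives both directions of the change of basis. The sizes [n]
    and [p] are separate because [U] will have [(n - nu) + nu] columns. *)
Lemma gain_orth (n p m : nat) (A : 'M[F]_n) (B : 'M[F]_(n, m)) (Q : 'M[F]_n)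
    (S : 'M[F]_(n, m)) (R : 'M[F]_m) (X : 'M[F]_n) (G : 'M[F]_(m, n))
    (U : 'M[F]_(n, p)) :
  U *m U^T = 1%:M ->
  gdare_gain A B Q S R X G ->
  gdare_gain (U^T *m A *m U) (U^T *m B) (U^T *m Q *m U) (U^T *m S) R
    (U^T *m X *m U) (G *m U).
Proof.
move=> UUt [VG eqX]; rewrite /gdare_gain !trmx_mul !trmxK.
have UK q (M : 'M_(q, n)) : M *m U *m U^T = M by rewrite -mulmxA UUt mulmx1.
rewrite !mulmxA !UK VG mulmxDl; split=> //.
by rewrite {1}eqX !(mulmxDl, mulmxDr, mulmxN, mulNmx) !mulmxA.
Qed.

(** * Deflation of the zero columns of the state matrix *)

Section Reduction.
Variables (p q m : nat) (At : 'M[F]_(p + q, p)) (B : 'M[F]_(p + q, m)).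
Variables (Q : 'M[F]_(p + q)) (R : 'M[F]_m).
Let A1 := usubmx At.
Let B1 := usubmx B.
Let Q1 := At^T *m Q *m At.
Let S1 := At^T *m Q *m B.
Let R1 := R + B^T *m Q *m B.
Hypothesis symQ : Q^T = Q.

(** Only the leading blocks of [M] and [N] meet [D]; the remaining term is what [Q1], [S1] and [R1]
    collect. *)
Lemma corner_mul (r s : nat) (M : 'M[F]_(p + q, r)) (N : 'M[F]_(p + q, s)) (D : 'M[F]_p) :
  M^T *m (Q + block_mx D 0 0 0) *m N
  = M^T *m Q *m N + (usubmx M)^T *m D *m usubmx N.
Proof.
rewrite mulmxDr mulmxDl; congr (_ + _).
rewrite -{1}[M]vsubmxK -{1}[N]vsubmxK tr_col_mx mul_row_block mul_row_col.
by rewrite !mulmx0 !addr0 mul0mx addr0.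
Qed.

Lemma gain_reduce (X : 'M[F]_(p + q)) (G : 'M[F]_(m, p + q)) :
  R^T = R -> X^T = X ->
  gdare_gain (row_mx At 0) B Q 0 R X G ->
  let D := ulsubmx X - ulsubmx Q in
  X = Q + block_mx D 0 0 0 /\ gdare_gain A1 B1 Q1 S1 R1 D (lsubmx G).
Proof.
move=> symR symX.
rewrite /gdare_gain trmx0 add0r tr_row_mx trmx0 mul_mx_row mulmx0 -[G]hsubmxK row_mxKl.
set G1 := lsubmx G; set G2 := rsubmx G; rewrite mul_mx_row => -[/eq_row_mx[VG1 VG2] eqX].
set D := ulsubmx X - ulsubmx Q.
have G2V : G2^T *m (R + B^T *m X *m B) = 0.
  by apply: trmx_inj; rewrite trmx_mul trmxK trmx0 -VG2 linearD /= sym_congr ?symR.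
(* The last columns of the state matrix vanish, and G2 is annihilated by [R + B^T *m X *m B] from
   either side, so only the leading block survives. *)
have eqD : X - Q = block_mx (At^T *m X *m At - G1^T *m ((R + B^T *m X *m B) *m G1)) 0 0 0.
  rewrite {1}eqX addrK mul_col_mx mul_col_row -(mulmxA (row_mx G1 G2)^T).
  rewrite mul_mx_row VG2 tr_row_mx mul_col_row !(mulmx0, mul0mx) opp_block_mx.
  by rewrite add_block_mx !oppr0 !addr0 (mulmxA G2^T) G2V mul0mx subr0.
have DE : D = ulsubmx (X - Q) by apply/matrixP => i j; rewrite !mxE.
have defX : X = Q + block_mx D 0 0 0.
  by rewrite DE eqD block_mxKul -eqD addrC subrK.
split=> //; rewrite /gdare_gain.
(* Both problems share this matrix, so the block G1 serves as gain for the reduced one. *)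
have VE : R + B^T *m X *m B = R1 + B1^T *m D *m B1 by rewrite {1}defX corner_mul addrA.
rewrite -VE; split.
  by rewrite VG1 {1}defX corner_mul trmx_mul trmx_mul trmxK symQ mulmxA.
rewrite {1}DE eqD block_mxKul {1}defX corner_mul mulmxA /Q1 /A1.
mx_ring.
Qed.

(** On the zero columns the gain equation is homogeneous, so the gain is completed by 0. *)
Lemma gain_extend (D : 'M[F]_p) (G : 'M[F]_(m, p)) :
  gdare_gain A1 B1 Q1 S1 R1 D G ->
  gdare_gain (row_mx At 0) B Q 0 R (Q + block_mx D 0 0 0) (row_mx G 0).
Proof.
rewrite /gdare_gain trmx0 add0r.
rewrite [_ + B^T *m _ *m B](_ : _ = R1 + B1^T *m D *m B1);
  last by rewrite corner_mul addrA.
move=> [VG eqD]; split.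
  rewrite !mul_mx_row !mulmx0 VG corner_mul.
  by rewrite trmx_mul trmx_mul trmxK symQ !mulmxA.
rewrite !tr_row_mx !trmx0 mul_col_mx mul_col_row corner_mul.
rewrite mul_col_mx mul_col_row !(mulmx0, mul0mx).
rewrite opp_block_mx add_block_mx !oppr0 !addr0 addrC; congr (_ + _).
by rewrite {1}eqD; congr block_mx; mx_ring.
Qed.
End Reduction.

Lemma orth_conj (n p : nat) (U : 'M[F]_(n, p)) (M : 'M[F]_n) :
  U *m U^T = 1%:M -> U *m (U^T *m M *m U) *m U^T = M.
Proof.
by move=> UUt; rewrite !mulmxA UUt mul1mx -mulmxA UUt mulmx1.
Qed.

(** The block matrix is the sum of the congruences of [Q] by [[At B]] and of [R] by [[0 1]]. *)
Lemma reduced_psd (p q m : nat) (At : 'M[F]_(p + q, p)) (B : 'M[F]_(p + q, m))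
    (Q : 'M[F]_(p + q)) (R : 'M[F]_m) :
  psd_mx Q -> psd_mx R ->
  psd_mx (block_mx (At^T *m Q *m At) (At^T *m Q *m B) (At^T *m Q *m B)^T
    (R + B^T *m Q *m B)).
Proof.
move=> psdQ psdR; have [symQ _] := psdQ.
have := psd_add (psd_congr (row_mx At B) psdQ) (psd_congr (row_mx 0 1%:M) psdR).
rewrite !tr_row_mx mul_col_mx mul_col_row mul_col_mx mul_col_row trmx0 trmx1 add_block_mx.
rewrite !(mul0mx, mulmx0, mul1mx, mulmx1, addr0) [_ + R]addrC.
by rewrite trmx_mul trmx_mul trmxK symQ mulmxA.
Qed.

Lemma cgdare_normal_form (n p m : nat) (A : 'M[F]_n) (B : 'M[F]_(n, m))
    (Q : 'M[F]_n) (S : 'M[F]_(n, m)) (R : 'M[F]_m) (U : 'M[F]_(n, p))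
    (X : 'M[F]_n) :
  psd_mx (block_mx Q S S^T R) -> orthogonal_mx U ->
  let A0 := A - B *m mpinv R *m S^T in
  let Q0 := Q - S *m mpinv R *m S^T in
  psd_mx Q0 /\
  (cgdare_solution A B Q S R X <->
   X^T = X /\ exists G,
     gdare_gain (U^T *m A0 *m U) (U^T *m B) (U^T *m Q0 *m U) 0 R (U^T *m X *m U) G).
Proof.
move=> psdPi [UtU UUt] A0 Q0; have [symR _] := psd_block_dr psdPi.
pose K := mpinv R *m S^T.
(* Positivity gives [S = D *m R], and R times its pseudo-inverse times R is R. *)
have RK : R *m K = S^T.
  have /submxP[D defS] := psd_block_cross psdPi.
  rewrite /K defS trmx_mul symR !mulmxA.
  by case/and4P: (mpinvP R) => /eqP -> _ _ _.
have defS : S = K^T *m R by rewrite -[LHS]trmxK -RK trmx_mul symR.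
have defQ0 : Q0 = Q - K^T *m R *m K by rewrite -defS mulmxA.
have defA : A = A0 + B *m K by rewrite /A0 /K mulmxA subrK.
split; first by rewrite defQ0; apply: psd_schur; rewrite -defS.
rewrite cgdareP // {1}defA {1}defS defQ0.
split=> -[symX [G gainG]]; split=> //.
  (* Remove the feedback, then change basis; the zero cross term is rewritten as [U^T *m 0] to fit
     [gain_orth]. *)
  exists ((G - K) *m U); rewrite -(mulmx0 _ U^T); apply: gain_orth => //.
  by apply/gain_feedback => //; rewrite subrK.
exists (G *m U^T + K); apply/gain_feedback => //.
have UtU' : U^T *m U^T^T = 1%:M by rewrite trmxK.
by have := gain_orth UtU' gainG; rewrite trmxK mulmx0 !orth_conj // mulmxA UUt mul1mx.
Qed.
End Gain.

Theorem theorem1 (F : realType) (n m : nat)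
    (A : 'M[F]_n) (B : 'M[F]_(n, m))
    (Q : 'M[F]_n) (S : 'M[F]_(n, m)) (R : 'M[F]_m)
    (hPi : psd_mx (block_mx Q S S^T R)) :
  let A0 := A - B *m mpinv R *m S^T in
  let Q0 := Q - S *m mpinv R *m S^T in
  let nu := \rank (colker A0) in
  forall (U1 : 'M[F]_(n, n - nu)) (U2 : 'M[F]_(n, nu)),
  let U := row_mx U1 U2 in
  orthogonal_mx U ->
  (colim U2 :=: colker A0)%MS ->
  let AU := U^T *m A0 *m U in
  let At := lsubmx AU in
  let A1 := usubmx At in
  let BU := U^T *m B in
  let B1 := usubmx BU in
  let QU := U^T *m Q0 *m U in
  let Q11 := ulsubmx QU in
  let Q12 := ursubmx QU in
  let Q22 := drsubmx QU in
  let Q1 := At^T *m QU *m At in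
  let S1 := At^T *m QU *m BU in
  let R1 := R + BU^T *m QU *m BU in
  (forall X : 'M[F]_n, cgdare_solution A B Q S R X ->
     let XU := U^T *m X *m U in
     [/\ ursubmx XU = Q12 /\ drsubmx XU = Q22,
         psd_mx (block_mx Q1 S1 S1^T R1)
       & cgdare_solution A1 B1 Q1 S1 R1 (ulsubmx XU - Q11)])
  /\
  (forall D1 : 'M[F]_(n - nu), cgdare_solution A1 B1 Q1 S1 R1 D1 ->
     cgdare_solution A B Q S R
       (U *m block_mx (D1 + Q11) Q12 Q12^T Q22 *m U^T)).
Proof.
move=> A0 Q0 nu U1 U2 U orthU imU2 AU At A1 BU B1 QU Q11 Q12 Q22 Q1 S1 R1.
have [UtU UUt] := orthU.
have psdR := psd_block_dr hPi; have [symR _] := psdR.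
(* The 0 is a dummy [X]: only the positivity of [Q0] is extracted. *)
have [psdQ0 _] := cgdare_normal_form A B 0 hPi orthU.
have psdQU : psd_mx QU by apply: psd_congr.
have [symQU _] := psdQU.
(* The columns of [U2] lie in the kernel of [A0]. *)
have defAU : AU = row_mx At 0.
  rewrite -[AU]hsubmxK; congr row_mx; rewrite /AU /U mul_mx_row row_mxKr -mulmxA.
  suff -> : A0 *m U2 = 0 by rewrite mulmx0.
  apply: trmx_inj; rewrite trmx_mul trmx0; apply/sub_kermxP.
  by rewrite -/(colker A0) -imU2.
have symR1 : R1^T = R1 by rewrite /R1 linearD /= sym_congr ?symR.
have tQ12 : dlsubmx QU = Q12^T by rewrite trmx_ursub symQU.
have blockD (D : 'M[F]_(n - nu)) :
    block_mx (D + Q11) Q12 Q12^T Q22 = QU + block_mx D 0 0 0.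
  by rewrite -tQ12 -[QU in RHS]submxK add_block_mx !addr0 addrC.
split=> [X solX XU | D1 solD1].
  have [_ [/(_ solX)[symX [G gainG]] _]] := cgdare_normal_form A B X hPi orthU.
  have symXU : XU^T = XU by apply: sym_congr.
  move: gainG; rewrite -/AU -/QU -/XU -/BU defAU.
  case/(gain_reduce symQU symR symXU) => defXU gainD.
  split.
  - by rewrite defXU -blockD block_mxKur block_mxKdr.
  - exact: reduced_psd.
  - apply/cgdareP => //; split; last by exists (lsubmx G).
    by rewrite linearB /= !trmx_ulsub symXU symQU.
move: solD1 => /(cgdareP _ _ _ _ _ symR1)[symD [G gainG]].
set X := U *m _ *m U^T.
have [_ [_ ]] := cgdare_normal_form A B X hPi orthU; apply; split.
  rewrite /X blockD !trmx_mul trmxK linearD /= tr_block_mx !trmx0 symD symQU.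
  by rewrite mulmxA.
have defXU : U^T *m X *m U = QU + block_mx D1 0 0 0.
  have := @orth_conj _ _ _ U^T (QU + block_mx D1 0 0 0).
  by rewrite trmxK /X blockD; apply.
exists (row_mx G 0); rewrite -/AU defAU defXU.
exact: gain_extend.
Qed.
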